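(* For every $\mathrm{PDL}^-$ formula $\varphi$ (over $\mathbb A,\mathbb P$), $\varphi$ is valid on $\mathrm{GREL}_{\mathrm{sfinlin}}$ if and only if $\varphi$ is derivable in the system $\mathcal H^-$ described in the context.
   Context: Fix disjoint sets $\mathbb{A}$ (term variables) and $\mathbb{P}$ (formula variables). A generalized structure $M$ consists of a nonempty set $|M|$, a binary relation $U^M\subseteq|M|^2$, relations $a^M\subseteq U^M$ ($a\in\mathbb A$) and sets $p^M\subseteq|M|$ ($p\in\mathbb P$). $\mathrm{GREL}_{\mathrm{sfinlin}}$ is the class of generalized structures with $|M|$ finite and $U^M$ a strict linear order on $|M|$. $\mathrm{PDL}^-$ (identity-free PDL) formulas and terms: $\varphi::=p\mid\varphi\to\varphi\mid\mathtt F\mid[t]\varphi$, $t::=a\mid t;t\mid t+t\mid t^+\mid \varphi?;t\mid t;\varphi?$ ($p\in\mathbb P$, $a\in\mathbb A$). Abbreviations $\neg,\vee,\wedge,\leftrightarrow,\mathtt T$ as usual and $\langle t\rangle\varphi=\neg[t]\neg\varphi$. Semantics in $M$: $[\![p]\!]=p^M$, $[\![\varphi\to\psi]\!]=(|M|\setminus[\![\varphi]\!])\cup[\![\psi]\!]$, $[\![\mathtt F]\!]=\emptyset$, $[\![[t]\varphi]\!]=\{x:\forall y((x,y)\in[\![t]\!]\Rightarrow y\in[\![\varphi]\!])\}$, $[\![a]\!]=a^M$, $;$ is relational composition, $+$ union, $\cdot^+$ transitive closure, $[\![\varphi?]\!]=\{(x,x):x\in[\![\varphi]\!]\}$. $\varphi$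 is valid on a class $\mathcal C$ if $[\![\varphi]\!]_M=|M|$ for all $M\in\mathcal C$. $\mathcal H^-$ has rules: from $\varphi$ and $\varphi\to\psi$ infer $\psi$; from $\varphi$ infer $[t]\varphi$. Axioms (for all $\mathrm{PDL}^-$ terms $t,u$ and formulas $\varphi,\psi$): all substitution instances (by $\mathrm{PDL}^-$ formulas) of valid propositional formulas; $[t;u]\varphi\leftrightarrow[t][u]\varphi$; $[t+u]\varphi\leftrightarrow[t]\varphi\wedge[u]\varphi$; $[t^+]\varphi\leftrightarrow([t]\varphi\wedge[t][t^+]\varphi)$; $([t]\varphi\wedge[t^+](\varphi\to[t]\varphi))\to[t^+]\varphi$; $[\psi?;t]\varphi\leftrightarrow(\psi\to[t]\varphi)$; $[t;\psi?]\varphi\leftrightarrow[t](\psi\to\varphi)$; $[t](\varphi\to\psi)\to([t]\varphi\to[t]\psi)$; and (Löb) $[t^+]([t^+]\varphi\to\varphi)\to[t^+]\varphi$. *)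

(* Defs.v *)
From Stdlib Require Import Relations RelationClasses List FinFun.

Set Implicit Arguments.

Section Syntax.

Variables A P : Type.

(* The tests [f?;t] and [t;f?] are primitive: there is no stand-alone test. *)
Inductive form : Type :=
| FVar : P -> form
| FImp : form -> form -> form
| FFalse : form
| FBox : term -> form -> form
with term : Type :=
| TVar : A -> term
| TComp : term -> term -> term
| TUnion : term -> term -> term
| TPlus : term -> term
| TTestL : form -> term -> term
| TTestR : term -> form -> term.

Definition FNot (f : form) : form := FImp f FFalse.
Definition FAnd (f g : form) : form := FNot (FImp f (FNot g)).
Definition FIff (f g : form) : form := FAnd (FImp f g) (FImp g f).

End Syntax.

Arguments FFalse {A P}.
Arguments FVar {A P} _.
Arguments TVar {A P} _.

Section Semantics.

Variables A P : Type.

Record gstruct : Type := GStruct {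
  carrier :> Type;
  carrier_nonempty : inhabited carrier;
  univ : relation carrier;
  rel_val : A -> relation carrier;
  rel_val_univ : forall a, inclusion carrier (rel_val a) univ;
  set_val : P -> carrier -> Prop
}.

Definition rel_comp (X : Type) (R S : relation X) : relation X :=
  fun x y => exists z, R x z /\ S z y.

Definition test_rel (X : Type) (D : X -> Prop) : relation X :=
  fun x y => x = y /\ D x.

Fixpoint fsem (M : gstruct) (f : form A P) : M -> Prop :=
  match f with
  | FVar p => set_val M p
  | FImp g h => fun x => ~ fsem M g x \/ fsem M h x
  | FFalse => fun _ => False
  | FBox t g => fun x => forall y, tsem M t x y -> fsem M g y
  end
with tsem (M : gstruct) (t : term A P) : relation M :=
  match t with
  | TVar a => rel_val M a
  | TComp u v => rel_comp (tsem M u) (tsem M v)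
  | TUnion u v => union M (tsem M u) (tsem M v)
  | TPlus u => clos_trans M (tsem M u)
  | TTestL g u => rel_comp (test_rel (fsem M g)) (tsem M u)
  | TTestR u g => rel_comp (tsem M u) (test_rel (fsem M g))
  end.

Definition valid_on (C : gstruct -> Prop) (f : form A P) : Prop :=
  forall M : gstruct, C M -> forall x : M, fsem M f x.

Definition strict_linear_order (X : Type) (R : relation X) : Prop :=
  StrictOrder R /\ forall x y, R x y \/ x = y \/ R y x.

Definition GREL_sfinlin (M : gstruct) : Prop :=
  Finite M /\ strict_linear_order (univ M).

End Semantics.

(* Propositional variables are indexed by [nat] rather than by [P], so that
   schemata with several metavariables remain available when [P] is small
   or empty. *)
Inductive prop_form : Type :=
| PVar : nat -> prop_form
| PImp : prop_form -> prop_form -> prop_form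
| PFalse : prop_form.

Fixpoint prop_eval (v : nat -> bool) (q : prop_form) : bool :=
  match q with
  | PVar n => v n
  | PImp q1 q2 => orb (negb (prop_eval v q1)) (prop_eval v q2)
  | PFalse => false
  end.

Definition prop_valid (q : prop_form) : Prop :=
  forall v, prop_eval v q = true.

Fixpoint prop_subst (A P : Type) (s : nat -> form A P) (q : prop_form)
  : form A P :=
  match q with
  | PVar n => s n
  | PImp q1 q2 => FImp (prop_subst s q1) (prop_subst s q2)
  | PFalse => FFalse
  end.

Declare Scope pdl_scope.

Section ProofSystem.

Variables A P : Type.
Implicit Types (f g : form A P) (t u : term A P).

Local Notation "[[ t ]] f" := (FBox t f)
  (at level 30, t at level 200, f at level 30, right associativity) : pdl_scope.
Local Notation "f /\ g" := (FAnd f g) : pdl_scope.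
Local Notation "f ==> g" := (FImp f g)
  (at level 85, right associativity) : pdl_scope.
Local Notation "f <=> g" := (FIff f g)
  (at level 90, no associativity) : pdl_scope.
Local Open Scope pdl_scope.

Inductive axiom : form A P -> Prop :=
| Ax_prop : forall q (s : nat -> form A P),
    prop_valid q -> axiom (prop_subst s q)
| Ax_comp : forall t u f,
    axiom ([[TComp t u]] f <=> [[t]] [[u]] f)
| Ax_union : forall t u f,
    axiom ([[TUnion t u]] f <=> [[t]] f /\ [[u]] f)
| Ax_plus : forall t f,
    axiom ([[TPlus t]] f <=> [[t]] f /\ [[t]] [[TPlus t]] f)
| Ax_ind : forall t f,
    axiom ([[t]] f /\ [[TPlus t]] (f ==> [[t]] f) ==> [[TPlus t]] f)
| Ax_testl : forall t f g,
    axiom ([[TTestL g t]] f <=> (g ==> [[t]] f))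
| Ax_testr : forall t f g,
    axiom ([[TTestR t g]] f <=> [[t]] (g ==> f))
| Ax_K : forall t f g,
    axiom ([[t]] (f ==> g) ==> ([[t]] f ==> [[t]] g))
| Ax_Lob : forall t f,
    axiom ([[TPlus t]] ([[TPlus t]] f ==> f) ==> [[TPlus t]] f).

Inductive derivable : form A P -> Prop :=
| D_axiom : forall f, axiom f -> derivable f
| D_mp : forall f g, derivable f -> derivable (f ==> g) -> derivable g
| D_nec : forall t f, derivable f -> derivable ([[t]] f).

End ProofSystem.

(* Main.v *)
(* Completeness: fix a finite Fischer–Ladner closure [cl] of the formula. The
   points of the model are pairs [(S, X)], where [S] is a sign vector on [cl]
   and [X] a set of sign vectors that do not occur after the point. If a point
   has an [a]-successor of theory [S'], then by Löb's axiom there is also a last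
   point of theory [S'] subject to the same constraint [X]; the edge is
   redirected to that point, and [X] becomes [S' |: X]. Hence edges strictly
   increase [X], so that the model is acyclic, and any linear extension serves
   as the universal relation. Redirection is harmless because the truth lemma
   depends on [S] only. Acyclicity also disposes of [t^+] by descent along
   edges, without the induction axiom. *)

From Stdlib Require Import Relations RelationClasses List FinFun Classical ClassicalEpsilon.
From mathcomp Require Import all_boot.
Require Import Defs.

Set Implicit Arguments.
Unset Strict Implicit.
Unset Printing Implicit Defensive.

Scheme form_term_ind := Induction for form Sort Prop
  with term_form_ind := Induction for term Sort Prop.
Combined Scheme form_term_mutind from form_term_ind, term_form_ind.

(** * Soundness *)

Section Soundness.

Variables A P : Type.
Implicit Types (f g : form A P) (t : term A P).

Lemma fsem_not (M : gstruct A P) f (x : M) : fsem M (FNot f) x <-> ~ fsem M f x.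
Proof. by rewrite /=; tauto. Qed.

Lemma fsem_imp (M : gstruct A P) f g (x : M) :
  fsem M (FImp f g) x <-> (fsem M f x -> fsem M g x).
Proof. by rewrite /=; case: (classic (fsem M f x)); tauto. Qed.

Lemma fsem_and (M : gstruct A P) f g (x : M) :
  fsem M (FAnd f g) x <-> fsem M f x /\ fsem M g x.
Proof.
rewrite fsem_not fsem_imp fsem_not.
by case: (classic (fsem M f x)); case: (classic (fsem M g x)); tauto.
Qed.

Lemma fsem_iff (M : gstruct A P) f g (x : M) :
  fsem M (FIff f g) x <-> (fsem M f x <-> fsem M g x).
Proof. by rewrite fsem_and !fsem_imp. Qed.

(** Classical truth at the point [x] supplies the boolean valuation. *)
Lemma fsem_prop_subst (M : gstruct A P) (s : nat -> form A P) q (x : M) :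
  let v n := if excluded_middle_informative (fsem M (s n) x) then true else false in
  fsem M (prop_subst s q) x <-> prop_eval v q = true.
Proof.
move=> v; elim: q => [n|q1 IH1 q2 IH2|].
- by rewrite /= /v; case: excluded_middle_informative.
- rewrite [prop_subst _ _]/= fsem_imp IH1 IH2 /=.
  by case: (prop_eval v q1); case: (prop_eval v q2) => /=; intuition.
- by [].
Qed.

Lemma tsem_univ (M : gstruct A P) t :
  StrictOrder (univ M) -> inclusion M (tsem M t) (univ M).
Proof.
move=> [_ trU]; elim: t => [a|u IHu v IHv|u IHu v IHv|u IHu|g u IHu|u IHu g] x y /=.
- exact: rel_val_univ.
- by move=> [z [/IHu xz /IHv zy]]; apply: trU xz zy.
- by case=> [/IHu|/IHv].
- by elim=> [? ? /IHu|? ? ? _ xy _ yz] //; apply: trU xy yz.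
- by move=> [z [[-> _] /IHu]].
- by move=> [z [/IHu xz [<- _]]].
Qed.

Lemma finite_strict_order_wf (X : Type) (R : relation X) :
  FinFun.Finite X -> StrictOrder R -> well_founded (fun x y => R y x).
Proof.
move=> [l0 full] [irr tr] x.
have above : forall y, R x y -> In y l0 by move=> y _; apply: full.
(* The list only has to contain the points above [x]; on passing to some [y] above [x],
   irreflexivity allows deleting [y] from it. *)
move: {full} (size l0) {-2}l0 (leqnn (size l0)) x above => n.
elim: n => [|n IH] l lel x above; constructor=> y xy.
  by case: l lel above => [_ /(_ y xy) []|].
have [l1 [l2 el]] := in_split _ _ (above y xy); subst l.
apply: (IH (l1 ++ l2)).
  by move: lel; rewrite !size_cat /= addnS ltnS.
move=> z yz; have := above z (tr _ _ _ xy yz).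
rewrite !in_app_iff /= => -[|[eyz|]]; [by left| |by right].
by case: (irr y); rewrite {2}eyz.
Qed.

Lemma axiom_sound f : axiom f -> valid_on (@GREL_sfinlin A P) f.
Proof.
move=> axf M [finM [ordM _]] x.
case: axf => [q s qv|t u h|t u h|t h|t h|t h g|t h g|t h g|t h].
- by apply/fsem_prop_subst/qv.
- apply/fsem_iff; split=> /= [H y xy z yz|H y [z [xz zy]]].
    by apply: H; exists y.
  exact: H xz _ zy.
- apply/fsem_iff; rewrite fsem_and; split=> /= [H|[H1 H2] y [/H1|/H2]//].
  by split=> y xy; apply: H; [left|right].
- apply/fsem_iff; rewrite fsem_and; split=> /= [H|[H1 H2] y /(@clos_trans_t1n M)].
    split=> y xy; first exact/H/t_step.
    by move=> z yz; apply: H; apply: t_trans yz; apply: t_step.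
  by case=> [z /H1 //|z w xz /(@clos_t1n_trans M) zw]; apply: H2 zw.
- rewrite fsem_imp fsem_and => -[/= H1 H2] y /(@clos_trans_tn1 M).
  elim=> [z /H1 //|z w zw xz hz].
  case: (H2 z) => [|/(_ hz)//|]; first exact: clos_tn1_trans.
  by apply.
- apply/fsem_iff; rewrite fsem_imp; split=> /= [H gx y xy|H y [z [[<- gx] xy]]].
    by apply: H; exists x.
  exact: H.
- apply/fsem_iff; split=> /= [H y xy|H y [z [xz [<- gz]]]].
    case: (classic (fsem M g y)) => gy; [right|by left].
    by apply: H; exists y.
  by case: (H z xz).
- rewrite !fsem_imp => /= H1 H2 y xy.
  by case: (H1 y xy) => // /(_ (H2 y xy)).
- rewrite fsem_imp => /= H y.
  (* Löb's axiom holds by induction from the maximal points downwards, since [t^+] only moves up in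
     the finite order. *)
  elim/(well_founded_ind (finite_strict_order_wf finM ordM)): y => y IH xy.
  case: (H y xy) => // -[] z yz.
  apply: IH; first exact: (@tsem_univ M (TPlus t)).
  exact: t_trans xy yz.
Qed.

Lemma derivable_sound f : derivable f -> valid_on (@GREL_sfinlin A P) f.
Proof.
elim=> {f} [f|f g _ IHf _ IHfg|t f _ IHf] => [axf|M CM x|M CM x /= y _].
- exact: axiom_sound.
- by move: (IHfg M CM x); rewrite fsem_imp; apply; apply: IHf.
- exact: IHf.
Qed.

End Soundness.

(** * Local consequence *)

Section Entailment.

Variables A P : Type.
Implicit Types (f g h : form A P) (t u : term A P) (G H : form A P -> Prop).

(* Necessitation is available for theorems only, so that the deduction theorem
   holds. *)
Inductive entails G : form A P -> Prop :=
| E_hyp f : G f -> entails G f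
| E_der f : derivable f -> entails G f
| E_mp f g : entails G (FImp f g) -> entails G f -> entails G g.

Definition consistent G := ~ entails G FFalse.

Definition add f G : form A P -> Prop := fun g => g = f \/ G g.

Definition adds (l : list (form A P)) G : form A P -> Prop :=
  fun g => In g l \/ G g.

Lemma entails_cut G H f :
  (forall g, G g -> entails H g) -> entails G f -> entails H f.
Proof.
move=> GH; elim=> {f} [f /GH //|f|f g _ IHfg _ IHf]; first exact: E_der.
exact: E_mp IHfg IHf.
Qed.

Lemma entails_weaken G H f :
  (forall g, G g -> H g) -> entails G f -> entails H f.
Proof. by move=> GH; apply: entails_cut => g /GH; apply: E_hyp. Qed.

Lemma entails_derivable f : entails (fun=> False) f -> derivable f.
Proof. by elim=> {f} [//|//|f g _ Hfg _ Hf]; apply: D_mp Hf Hfg. Qed.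

Lemma taut G q (fs : list (form A P)) :
  prop_valid q -> entails G (prop_subst (nth FFalse fs) q).
Proof. by move=> qv; apply/E_der/D_axiom/Ax_prop. Qed.

Ltac taut q fs :=
  apply: (@taut _ q fs); let v := fresh "v" in intro v; simpl;
  destruct (v 0), (v 1), (v 2); reflexivity.

(** The deduction theorem, by the usual induction on derivations in a Hilbert system. *)
Lemma entails_imp G f g : entails (add f G) g <-> entails G (FImp f g).
Proof.
split=> [|Gfg]; last first.
  apply: (@E_mp _ f); last by apply: E_hyp; left.
  by apply: entails_weaken Gfg => h; right.
have wk h : entails G h -> entails G (FImp f h).
  apply: E_mp; by taut (PImp (PVar 0) (PImp (PVar 1) (PVar 0))) [:: h; f].
elim=> {g} [g [->|Gg]|g|g h _ IHgh _ IHg].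
- by taut (PImp (PVar 0) (PVar 0)) [:: f].
- exact/wk/E_hyp.
- by move=> ?; apply/wk/E_der.
- apply: E_mp IHg; apply: E_mp IHgh.
  by taut (PImp (PImp (PVar 0) (PImp (PVar 1) (PVar 2)))
     (PImp (PImp (PVar 0) (PVar 1)) (PImp (PVar 0) (PVar 2)))) [:: f; g; h].
Qed.

Lemma entails_absurd G f : entails (add (FNot f) G) FFalse -> entails G f.
Proof.
move=> /entails_imp; apply: E_mp.
by taut (PImp (PImp (PImp (PVar 0) PFalse) PFalse) (PVar 0)) [:: f].
Qed.

Lemma entails_not_imp G f g : entails G (FNot f) -> entails G (FImp f g).
Proof.
by apply: E_mp; taut (PImp (PImp (PVar 0) PFalse) (PImp (PVar 0) (PVar 1))) [:: f; g].
Qed.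

Lemma entails_and G f g :
  entails G (FAnd f g) <-> entails G f /\ entails G g.
Proof.
pose qand := PImp (PImp (PVar 0) (PImp (PVar 1) PFalse)) PFalse.
split=> [Gfg|[Gf Gg]].
  split; apply: E_mp Gfg.
    by taut (PImp qand (PVar 0)) [:: f; g].
  by taut (PImp qand (PVar 1)) [:: f; g].
apply: E_mp Gg; apply: E_mp Gf.
by taut (PImp (PVar 0) (PImp (PVar 1) qand)) [:: f; g].
Qed.

Lemma entails_iff G f g :
  entails G (FIff f g) -> (entails G f <-> entails G g).
Proof. by move=> /entails_and [fg gf]; split; apply: E_mp. Qed.

Lemma entails_comp G t u f :
  entails G (FBox (TComp t u) f) <-> entails G (FBox t (FBox u f)).
Proof. exact/entails_iff/E_der/D_axiom/Ax_comp. Qed.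

Lemma entails_union G t u f :
  entails G (FBox (TUnion t u) f) <->
  entails G (FBox t f) /\ entails G (FBox u f).
Proof. by rewrite -entails_and; apply/entails_iff/E_der/D_axiom/Ax_union. Qed.

Lemma entails_plus G t f :
  entails G (FBox (TPlus t) f) <->
  entails G (FBox t f) /\ entails G (FBox t (FBox (TPlus t) f)).
Proof. by rewrite -entails_and; apply/entails_iff/E_der/D_axiom/Ax_plus. Qed.

Lemma entails_testl G t f g :
  entails G (FBox (TTestL g t) f) <-> entails G (FImp g (FBox t f)).
Proof. exact/entails_iff/E_der/D_axiom/Ax_testl. Qed.

Lemma entails_testr G t f g :
  entails G (FBox (TTestR t g) f) <-> entails G (FBox t (FImp g f)).
Proof. exact/entails_iff/E_der/D_axiom/Ax_testr. Qed.

(** Stated for arbitrary operators on formulas, so that a constant operator qualifies when there is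
    no atom to build a term from. *)
Definition normal (bx : form A P -> form A P) :=
  (forall f, derivable f -> derivable (bx f)) /\
  (forall f g, derivable (FImp (bx (FImp f g)) (FImp (bx f) (bx g)))).

Lemma box_normal t : normal (FBox t).
Proof. by split=> [f|f g]; [apply: D_nec|apply/D_axiom/Ax_K]. Qed.

(** Necessitation and K make the formulas whose box follows from [G] closed under local
    consequence. *)
Lemma normal_entails bx G f :
  normal bx -> entails (fun g => entails G (bx g)) f -> entails G (bx f).
Proof.
move=> [nec K]; elim=> {f} [//|f /nec|f g _ Gfg _ Gf]; first exact: E_der.
by apply: E_mp Gf; apply: E_mp Gfg; apply/E_der/K.
Qed.

(** The nested implication is the curried negation of the conjunction of [l]. *)
Lemma entails_imps l G :
  entails G (foldr (@FImp A P) FFalse l) <-> ~ consistent (adds l G).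
Proof.
rewrite /consistent; elim: l G => [|f l IH] G /=.
  split=> [GF H|/NNPP]; first by apply: H; apply: entails_weaken GF; right.
  by apply: entails_weaken => g [].
rewrite -entails_imp IH; split=> nc c; apply: nc => inc; apply: c;
  apply: entails_weaken inc => g; rewrite /adds /add /=; intuition.
Qed.

Definition signed (bs : list bool) (l : list (form A P)) :=
  [seq if p.1 then p.2 else FNot p.2 | p <- zip bs l].

Lemma signed_decides bs l f :
  size bs = size l -> In f l -> In f (signed bs l) \/ In (FNot f) (signed bs l).
Proof.
elim: l bs => [|g l IH] [|b bs] //= [sz] [->|inl].
  by case: b; [left|right]; left.
by case: (IH bs sz inl) => ?; [left|right]; right.
Qed.

(** Only the finite list [l] is decided, one formula at a time; if [f] is inconsistent with [G],
    then [FNot f] can be added. *)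
Lemma lindenbaum l G :
  consistent G ->
  exists2 bs, size bs = size l & consistent (adds (signed bs l) G).
Proof.
elim: l G => [|f l IH] G cG.
  by exists [::] => //; apply: contra_not cG; apply: entails_weaken => g [].
have [b cb] : exists b : bool, consistent (add (if b then f else FNot f) G).
  case: (classic (consistent (add f G))) => [?|/NNPP /entails_imp Gnf].
    by exists true.
  exists false; apply: contra_not cG => nc.
  by apply: (E_mp Gnf); exact: entails_absurd.
have [bs sz cbs] := IH _ cb.
exists (b :: bs); first by rewrite /= sz.
apply: contra_not cbs; apply: entails_weaken => g.
by rewrite /adds /add /signed /=; intuition.
Qed.

(** * Gödel–Löb operators *)

(** A modality of provability logic that dominates the atomic boxes of [s], to be read as truth at
    all later points. *)
Definition GL_operator (bx : form A P -> form A P) (s : list A) :=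
  [/\ normal bx,
      forall f, derivable (FImp (bx f) (bx (bx f))),
      forall f, derivable (FImp (bx (FImp (bx f) f)) (bx f))
    & forall a f, In a s -> derivable (FImp (bx f) (FBox (TVar a) f))].

(** The induction axiom is applied to [[t^+]f] itself; its base and step come from unfolding. The
    completeness direction uses that axiom only here. *)
Lemma derivable_plus_trans t f :
  derivable (FImp (FBox (TPlus t) f) (FBox (TPlus t) (FBox (TPlus t) f))).
Proof.
apply/entails_derivable/entails_imp; set G := add _ _.
have /entails_plus[_ step] : entails G (FBox (TPlus t) f) by apply: E_hyp; left.
apply: E_mp (E_der _ (D_axiom (Ax_ind t (FBox (TPlus t) f)))) _.
apply/entails_and; split=> //; apply/E_der/D_nec/entails_derivable/entails_imp.
by apply: (proj2 (proj1 (entails_plus _ _ _) _)); apply: E_hyp; left.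
Qed.

Lemma GL_operator_exists (s : list A) : exists bx, GL_operator bx s.
Proof.
case: s => [|a s].
  have taut_true f : derivable (FImp f (FImp FFalse (@FFalse A P))).
    by apply/entails_derivable; taut (PImp (PVar 0) (PImp PFalse PFalse)) [:: f].
  have tt : derivable (FImp FFalse (@FFalse A P)).
    by apply/entails_derivable; taut (PImp PFalse PFalse) (@nil (form A P)).
  (* Without atoms there may be no term at all; the constantly true operator satisfies the last
     clause vacuously. *)
  exists (fun=> FImp FFalse FFalse); split=> //; split=> // f g.
  by apply: D_mp tt _; apply/entails_derivable;
    taut (PImp (PVar 0) (PImp (PVar 1) (PImp (PVar 0) (PVar 0))))
      [:: FImp FFalse (@FFalse A P); FImp FFalse FFalse].
(* The sum of all listed atoms, with [a] as innermost summand because there is no empty sum. *)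
pose t := foldr (fun b u => TUnion (TVar b) u) (@TVar A P a) s.
exists (FBox (TPlus t)); split=> [|f|f|b f inb].
- exact: box_normal.
- exact: derivable_plus_trans.
- exact/D_axiom/Ax_Lob.
apply/entails_derivable/entails_imp; set G := add _ _.
have /entails_plus[+ _] : entails G (FBox (TPlus t) f) by apply: E_hyp; left.
move: G => G; rewrite {}/t; elim: s inb => [|c s IH] /= inb.
  by case: inb => [->|].
move=> /entails_union[Gc Gs]; case: inb => [eab|[<-//|inb]].
  by apply: IH => //; left.
by apply: IH => //; right.
Qed.

End Entailment.

(** * Fischer–Ladner closure *)

Section Closure.

Variables A P : Type.
Implicit Types (f g : form A P) (t : term A P) (l : list (form A P)).

(** One-step Fischer-Ladner unfolding, read off from the axioms. Tested formulas are included
    because theories must decide them. *)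
Definition reducts f : list (form A P) :=
  match f with
  | FImp g h => [:: g; h]
  | FBox t h => h ::
      match t with
      | TVar _ => [::]
      | TComp u v => [:: FBox u (FBox v h); FBox v h]
      | TUnion u v => [:: FBox u h; FBox v h]
      | TPlus u => [:: FBox u h; FBox u (FBox (TPlus u) h)]
      | TTestL g u => [:: g; FBox u h]
      | TTestR u g => [:: g; FBox u (FImp g h); FImp g h]
      end
  | _ => [::]
  end.

(** Reducts may escape into [E], whose members are closed off elsewhere; this lets the lists
    obtained for subterms be glued together. *)
Definition closed_mod (E : list (form A P)) l :=
  forall f, In f l -> incl (reducts f) (l ++ E).

Lemma closed_mod_app E l1 l2 :
  closed_mod (l2 ++ E) l1 -> closed_mod (l1 ++ E) l2 -> closed_mod E (l1 ++ l2).
Proof.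
move=> c1 c2 f /in_app_iff[/c1|/c2] c g /c; rewrite !in_app_iff; intuition.
Qed.

Lemma closed_mod_cons E f l :
  incl (reducts f) (f :: l ++ E) -> closed_mod (f :: E) l ->
  closed_mod E (f :: l).
Proof.
move=> cf cl g /= [<-//|/cl c] h /c; rewrite /= !in_app_iff /=; intuition.
Qed.

Lemma closed_modS E E' l : closed_mod E l -> incl E E' -> closed_mod E' l.
Proof.
by move=> c sub f /c cf g /cf; rewrite !in_app_iff => -[|/sub]; [left|right].
Qed.

(** The term part allows every continuation [f], since composition and iteration put new formulas
    under the box of a subterm. *)
Lemma closures :
  (forall f, exists2 l, In f l & closed_mod [::] l) /\
  (forall t f, exists2 l, In (FBox t f) l & closed_mod [:: f] l).
Proof.
apply: form_term_mutind => [p|f [lf inf cf] g [lg ing cg]||t IHt f [lf inf cf]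
  |a f|u IHu v IHv f|u IHu v IHv f|u IHu f|g [lg ing cg] u IHu f
  |u IHu g [lg ing cg] f].
- exists [:: FVar p]; first by left.
  by move=> ? [<-|].
- exists (FImp f g :: lf ++ lg); first by left.
  apply: closed_mod_cons.
    by move=> h /= [|[|]] // <-; rewrite !in_app_iff; auto.
  apply: closed_mod_app.
    by apply: closed_modS cf _.
  by apply: closed_modS cg _.
- exists [:: FFalse]; first by left.
  by move=> ? [<-|].
- have [l inl cl] := IHt f.
  exists (l ++ lf); first by apply/in_app_iff; left.
  apply: closed_mod_app; last exact: closed_modS cf _.
  by apply: closed_modS cl _ => ? [<-|//]; apply/in_app_iff; left.
- exists [:: FBox (TVar a) f]; first by left.
  by move=> ? [<-|//] h /= [<-|//]; right; left.
- have [l1 in1 c1] := IHv f; have [l2 in2 c2] := IHu (FBox v f).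
  exists (FBox (TComp u v) f :: l1 ++ l2); first by left.
  apply: closed_mod_cons.
    by move=> h /= [|[|[|]]] // <-; rewrite !in_app_iff /=; auto.
  apply: closed_mod_app.
    by apply: closed_modS c1 _ => ? [<-|//]; rewrite in_app_iff /=; auto.
  by apply: closed_modS c2 _ => ? [<-|//]; rewrite in_app_iff /=; auto.
- have [l1 in1 c1] := IHv f; have [l2 in2 c2] := IHu f.
  exists (FBox (TUnion u v) f :: l1 ++ l2); first by left.
  apply: closed_mod_cons.
    by move=> h /= [|[|[|]]] // <-; rewrite !in_app_iff /=; auto.
  apply: closed_mod_app.
    by apply: closed_modS c1 _ => ? [<-|//]; rewrite in_app_iff /=; auto.
  by apply: closed_modS c2 _ => ? [<-|//]; rewrite in_app_iff /=; auto.
(* The continuation [[u^+]f] of the second list is the head of the list being built, so the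
   unfolding loops back. *)
- have [l1 in1 c1] := IHu f; have [l2 in2 c2] := IHu (FBox (TPlus u) f).
  exists (FBox (TPlus u) f :: l1 ++ l2); first by left.
  apply: closed_mod_cons.
    by move=> h /= [|[|[|]]] // <-; rewrite !in_app_iff /=; auto.
  apply: closed_mod_app.
    by apply: closed_modS c1 _ => ? [<-|//]; rewrite in_app_iff /=; auto.
  by apply: closed_modS c2 _ => ? [<-|//]; rewrite in_app_iff /=; auto.
- have [l inl cl] := IHu f.
  exists (FBox (TTestL g u) f :: lg ++ l); first by left.
  apply: closed_mod_cons.
    by move=> h /= [|[|[|]]] // <-; rewrite !in_app_iff /=; auto.
  apply: closed_mod_app.
    by apply: closed_modS cg _.
  by apply: closed_modS cl _ => ? [<-|//]; rewrite in_app_iff /=; auto.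
- have [l inl cl] := IHu (FImp g f).
  exists (FBox (TTestR u g) f :: FImp g f :: lg ++ l); first by left.
  apply: closed_mod_cons.
    by move=> h /= [|[|[|[|]]]] // <-; rewrite !in_app_iff /=; auto 6.
  apply: closed_mod_cons.
    by move=> h /= [|[|]] // <-; rewrite !in_app_iff /=; auto 6.
  apply: closed_mod_app.
    by apply: closed_modS cg _.
  by apply: closed_modS cl _ => ? [<-|//]; rewrite in_app_iff /=; auto.
Qed.

End Closure.

(** * Completeness *)

Section Completeness.

Variables A P : Type.
Implicit Types (f g : form A P) (t : term A P).

Variable cl : list (form A P).
Hypothesis cl_closed : closed_mod [::] cl.

(** Successors are needed only for the finitely many atoms that head a box in [cl]. *)
Variable bx : form A P -> form A P.
Hypothesis bxGL : GL_operator bx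
  (flat_map (fun f => if f is FBox (TVar a) _ then [:: a] else [::]) cl).

(** * The canonical structure *)

Notation signs := ((size cl).-tuple bool).

Definition theory (S : signs) : form A P -> Prop :=
  fun f => In f (signed S cl).

Definition refutation (S : signs) := foldr (@FImp A P) FFalse (signed S cl).

Definition never_again (X : {set signs}) : form A P -> Prop :=
  fun f => exists2 S, S \in X & f = bx (refutation S).

(* [(S, X)] stands for a point of theory [S] after which no theory in [X]
   occurs. *)
Definition state := (signs * {set signs})%type.

Definition admissible (x : state) :=
  consistent (adds (signed x.1 cl) (never_again x.2)).

(** Comparing the sizes of the constraint sets suffices for acyclicity. Inadmissible states stay in
    the carrier but are never reached by an edge. *)
Definition edge (a : A) : relation state := fun x y =>
  [/\ #|x.2| < #|y.2|, admissible y &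
    forall f, In (FBox (TVar a) f) cl ->
      entails (theory x.1) (FBox (TVar a) f) -> entails (theory y.1) f].

(** The lexicographic pair of constraint size and enumeration index, coded as one number: an
    injective rank that increases along edges. *)
Definition rank (x : state) := #|x.2| * #|{: state}| + enum_rank x.

Lemma rank_inj : injective rank.
Proof.
move=> x y; rewrite /rank => exy; apply: enum_rank_inj; apply: val_inj => /=.
have := congr1 (modn^~ #|{: state}|) exy.
by rewrite /= !modnMDl !modn_small.
Qed.

Lemma rank_lt (x y : state) : #|x.2| < #|y.2| -> rank x < rank y.
Proof.
move=> lxy; rewrite /rank.
apply: (@leq_trans (#|x.2|.+1 * #|{: state}|)).
  by rewrite mulSn addnC ltn_add2r.
by apply: leq_trans (leq_addr _ _); rewrite leq_mul2r lxy orbT.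
Qed.

Definition canonical_struct : gstruct A P.
Proof.
apply: (@GStruct A P state _ (fun x y => rank x < rank y) edge _ 
         (fun p x => entails (theory x.1) (FVar p))).
- by split; apply: ([tuple of nseq (size cl) true], set0).
- by move=> a x y [/rank_lt].
Defined.

Lemma canonical_GREL : GREL_sfinlin canonical_struct.
Proof.
split.
  exists (enum {: state}) => x.
  have : x \in enum {: state} by rewrite mem_enum.
  elim: (enum _) => //= y s IH; rewrite inE => /predU1P[->|/IH]; first by left.
  by right.
split; first split=> [x|x y z]; rewrite /complement /= ?ltnn //.
  exact: ltn_trans.
move=> x y; case: (ltngtP (rank x) (rank y)) => [||/rank_inj]; auto.
Qed.

(** * Successors and the truth lemma *)

Lemma theory_decides (S : signs) f : In f cl ->
  entails (theory S) f \/ entails (theory S) (FNot f).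
Proof.
move=> inf; have := signed_decides (size_tuple S) inf.
by case=> ?; [left|right]; apply: E_hyp.
Qed.

Lemma admissible_theory x : admissible x -> consistent (theory x.1).
Proof. by apply: contra_not; apply: entails_weaken; left. Qed.

(* Löb's axiom provides the last occurrence of [S]. *)
Lemma last_occurrence (S : signs) (X : {set signs}) :
  admissible (S, X) -> admissible (S, S |: X).
Proof.
move=> adm nadm; apply: (proj1 (entails_imps _ _) _ adm) => /=.
case: bxGL => nbx tr lob _.
(* Inadmissibility of [(S, S |: X)] means that the constraints from [X] with [bx (refutation S)]
   refute [S]. *)
have H : entails (never_again X) (FImp (bx (refutation S)) (refutation S)).
  apply/entails_imp/entails_imps; apply=> /=.
  apply: entails_weaken nadm => g [|[S']]; first by left.
  rewrite in_setU1 => /predU1P[->|S'X] ->; right; [by left|right].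
  by exists S'.
apply: (E_mp H); apply: E_mp (E_der _ (lob _)) _.
(* By transitivity the constraints entail their own boxes, so [H] can be boxed and Löb's axiom
   applied. *)
apply: normal_entails => //; apply: entails_cut H => g [S' S'X ->].
apply: E_hyp; apply: E_mp (E_der _ (tr _)) _.
by apply: E_hyp; exists S'.
Qed.

(** The new theory [S'] extends [FNot f] and the set [D] of formulas forced after an [a]-step; [S']
    itself then joins the constraint set. *)
Lemma edge_exists (x : state) a f : In (FBox (TVar a) f) cl ->
  admissible x -> ~ entails (theory x.1) (FBox (TVar a) f) ->
  exists2 y, edge a x y & ~ entails (theory y.1) f.
Proof.
case: x => S X /= inaf adm naf; case: bxGL => nbx tr _ ats.
pose G := adds (signed S cl) (never_again X).
pose D g := entails G (FBox (TVar a) g).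
have cD : consistent (add (FNot f) D).
  move=> /entails_absurd; rewrite /D => /(normal_entails (box_normal _)) Gaf.
  case: (theory_decides S inaf) => // Snaf; apply: adm.
  by apply: E_mp Gaf; apply: entails_weaken Snaf; left.
have [bs sz cbs] := lindenbaum cl cD.
have szb : size bs == size cl by rewrite sz.
pose S' : signs := Tuple szb.
have ina : In a (flat_map
    (fun f => if f is FBox (TVar a) _ then [:: a] else [::]) cl).
  by apply/in_flat_map; exists (FBox (TVar a) f); split=> //; left.
(* As [bx] dominates [[a]], theories in [X] are refuted right after the step, so that [S'] is new,
   and by transitivity they stay excluded. *)
have DX S0 : S0 \in X -> D (refutation S0) /\ D (bx (refutation S0)).
  move=> S0X.
  have GS0 : entails G (bx (refutation S0)) by apply: E_hyp; right; exists S0.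
  split; apply: E_mp (E_der _ (ats _ _ ina)) _ => //.
  exact: E_mp (E_der _ (tr _)) _.
have adm' : admissible (S', X).
  apply: contra_not cbs; apply: entails_weaken => g [|[S0 S0X ->]]; first by left.
  by right; right; case: (DX S0 S0X).
have S'X : S' \notin X.
  apply/negP => /DX[DS' _]; apply: (proj1 (entails_imps _ _) _ cbs).
  by apply: E_hyp; right.
exists (S', S' |: X) => /=; last first.
  move=> S'f; apply: cbs; apply: (@E_mp _ _ _ f).
    by apply: E_hyp; right; left.
  by apply: entails_weaken S'f; left.
split=> [||g ing Sg].
- by rewrite cardsU1 S'X.
- exact: last_occurrence.
- have ing' : In g cl.
    by have := cl_closed ing (or_introl erefl); rewrite cats0.
  case: (theory_decides S' ing') => // S'ng; case: cbs; apply: (@E_mp _ _ _ g).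
    by apply: entails_weaken S'ng; left.
  by apply: E_hyp; right; right; apply: entails_weaken Sg; left.
Qed.

(** Freeness from identity enters here: every term contains an atomic step, so no transition can
    stay in place. *)
Lemma tsem_progress t (x y : canonical_struct) :
  tsem canonical_struct t x y -> #|x.2| < #|y.2| /\ admissible y.
Proof.
elim: t x y => [a|u IHu v IHv|u IHu v IHv|u IHu|g u IHu|u IHu g] x y /=.
- by case.
- move=> [z [/IHu [xz _] /IHv [zy ay]]]; split=> //; exact: ltn_trans zy.
- by case=> [/IHu|/IHv].
- elim=> [? ? /IHu|? ? ? _ [xy _] _ [yz az]] //; split=> //.
  exact: ltn_trans yz.
- by move=> [z [[-> _] /IHu]].
- by move=> [z [/IHu xz [<- _]]].
Qed.

(** The term part speaks of entailment of [f] at the targets, not of truth, because [f] is not a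
    part of [t] and has no induction hypothesis there; the box case joins both parts. *)
Lemma truth :
  (forall f, In f cl -> forall x : canonical_struct, admissible x ->
     (fsem canonical_struct f x <-> entails (theory x.1) f)) /\
  (forall t f, In (FBox t f) cl ->
     forall x : canonical_struct, admissible x ->
     ((forall y, tsem canonical_struct t x y -> entails (theory y.1) f) <->
      entails (theory x.1) (FBox t f))).
Proof.
have red f g : In f cl -> In g (reducts f) -> In g cl.
  by move=> /cl_closed c /c; rewrite cats0.
apply: form_term_mutind => [p|f IHf g IHg||t IHt f IHf
  |a|u IHu v IHv|u IHu v IHv|u IHu|g IHg u IHu|u IHu g IHg].
- by [].
- move=> infg x adm; rewrite fsem_imp.
  have inf : In f cl by apply: red infg _; left.
  have ing : In g cl by apply: red infg _; right; left.
  rewrite IHf // IHg //; split=> [H|]; last exact: E_mp.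
  case: (theory_decides x.1 inf) => [/H Hg|]; last exact: entails_not_imp.
  by apply/entails_imp; apply: entails_weaken Hg; right.
- move=> _ x adm; split=> // /=; exact: admissible_theory.
- move=> intf x adm; rewrite -IHt //=.
  have inf : In f cl by apply: red intf _; left.
  by split=> H y xy; apply/(IHf inf); try exact: H;
    case: (tsem_progress xy).
- move=> f inf x adm; split=> [H|H y [_ _]]; last exact.
  by apply: NNPP => /(edge_exists inf adm)[y /H].
- move=> f inf x adm; rewrite entails_comp -IHu //; last first.
    by apply: red inf _; right; left.
  have invf : In (FBox v f) cl by apply: red inf _; right; right; left.
  split=> [H y xy|H y [z [xz zy]]].
    have [_ ay] := tsem_progress xy.
    by apply/(IHv _ invf y ay) => z yz; apply: H; exists y.
  have [_ az] := tsem_progress xz.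
  by apply: (proj2 (IHv _ invf z az) (H z xz)).
- move=> f inf x adm; rewrite entails_union -IHu //; last first.
    by apply: red inf _; right; left.
  rewrite -IHv //; last by apply: red inf _; right; right; left.
  split=> [H|[H1 H2] y [/H1|/H2]//].
  by split=> y xy; apply: H; [left|right].
- move=> f inf.
  have inuf : In (FBox u f) cl by apply: red inf _; right; left.
  have inuuf : In (FBox u (FBox (TPlus u) f)) cl.
    by apply: red inf _; right; right; left.
  move=> x adm; split=> [|H y xy]; last first.
    elim: (@clos_trans_t1n _ _ _ _ xy) adm H => [z w zw|z w v zw _ IH] az.
      by move=> /entails_plus[/(IHu _ inuf z az) + _]; apply.
    have [_ aw] := tsem_progress zw.
    by move=> /entails_plus[_ /(IHu _ inuuf z az)/(_ _ zw)]; apply: IH.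
  (* Induction on the number of theories not yet excluded, which drops at every [u]-step. *)
  have [n] := ubnP (#|{: signs}| - #|x.2|).
  elim: n x adm => // n IH x adm; rewrite ltnS => len H.
  apply/entails_plus; rewrite -IHu // -IHu //; split=> y xy.
    by apply: H; apply: t_step.
  have [lxy ay] := tsem_progress xy; apply: IH => // [|z yz].
    apply: leq_trans len; apply: ltn_sub2l => //.
    exact: leq_trans lxy (max_card _).
  by apply: H; apply: t_trans yz; apply: t_step.
- move=> f inf x adm; rewrite entails_testl.
  have ing : In g cl by apply: red inf _; right; left.
  have inuf : In (FBox u f) cl by apply: red inf _; right; right; left.
  split=> [H|H y [z [[<- gx] xy]]].
    case: (theory_decides x.1 ing) => [Hg|]; last exact: entails_not_imp.
    apply/entails_imp; apply: (@entails_weaken _ _ (theory x.1)); first by right.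
    apply/IHu => // y xy; apply: H; exists x; split=> //; split=> //.
    exact/IHg.
  move: xy; apply: (proj2 (IHu _ inuf x adm)).
  by apply: E_mp H _; apply/IHg.
- move=> f inf x adm; rewrite entails_testr.
  have ing : In g cl by apply: red inf _; right; left.
  rewrite -IHu //; last by apply: red inf _; right; right; left.
  have infg : In (FImp g f) cl by apply: red inf _; right; right; right; left.
  split=> [H y xy|H y [z [xz [<- gz]]]].
    have [_ ay] := tsem_progress xy.
    case: (theory_decides y.1 ing) => [Hg|]; last exact: entails_not_imp.
    apply/entails_imp; apply: (@entails_weaken _ _ (theory y.1)); first by right.
    by apply: H; exists y; split=> //; split=> //; apply/IHg.
  have [_ az] := tsem_progress xz.
  by apply: E_mp (H z xz) _; apply/IHg.
Qed.

Lemma canonical_complete phi : In phi cl ->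
  valid_on (@GREL_sfinlin A P) phi -> derivable phi.
Proof.
move=> inphi valid; apply/entails_derivable/entails_absurd; apply: NNPP => c.
have [bs sz cbs] := lindenbaum cl c.
have szb : size bs == size cl by rewrite sz.
(* The empty constraint set reduces admissibility to consistency of the theory. *)
pose x : canonical_struct := (Tuple szb, set0).
have adm : admissible x.
  by apply: contra_not cbs; apply: entails_weaken => g [|[S]]; [left|rewrite inE].
have := proj1 (proj1 truth _ inphi x adm) (valid _ canonical_GREL x).
move=> H; apply: cbs; apply: (@E_mp _ _ _ phi).
  by apply: E_hyp; right; left.
by apply: entails_weaken H; left.
Qed.

End Completeness.

Theorem theorem2 (A P : Type) (phi : form A P) :
  valid_on (@GREL_sfinlin A P) phi <-> derivable phi.
Proof.
split; last exact: derivable_sound.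
have [cl inphi cl_closed] := proj1 (closures A P) phi.
have [bx bxGL] := GL_operator_exists P
  (flat_map (fun f => if f is FBox (TVar a) _ then [:: a] else [::]) cl).
exact: canonical_complete cl_closed bx bxGL phi inphi.
Qed.
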